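(* Let $(N,L)$ be a pair of finite dimensional nilpotent Lie superalgebras over $\mathbb{F}$ such that $N$ has a complement in $L$ and $\dim N=(m|n)$. If $$\dim \mathcal{M}(N,L)= \frac{1}{2}\big((m+n)^2+(n-m)\big)+\dim N\,\dim(L/N)-1,$$ then $L$ is a non-abelian Lie superalgebra for which one of the following holds: (i) $[N,L]=0$; (ii) $\dim [N,L]=1$ and $[N,L]=Z(N,L)$.
   Context: Let $\mathbb{F}$ be an algebraically closed field of characteristic $\neq 2,3$; all superspaces and superalgebras are over $\mathbb{F}$. A Lie superalgebra is a $\mathbb{Z}_2$-graded vector space $L=L_0\oplus L_1$ with a bilinear bracket such that $[L_a,L_b]\subseteq L_{a+b}$, and for homogeneous $x,y,z$ (with $|x|$ denoting the degree of $x$): $[x,y]=-(-1)^{|x||y|}[y,x]$ and $(-1)^{|x||z|}[x,[y,z]]+(-1)^{|y||x|}[y,[z,x]]+(-1)^{|z||y|}[z,[x,y]]=0$. $L$ is abelian if its bracket is zero. For graded subspaces $A,B$, $[A,B]$ denotes the linear span of all brackets $[a,b]$, $a\in A$, $b\in B$. $L$ is nilpotent if $L^{c}=0$ for some $c$, where $L^1=L$ and $L^{i+1}=[L^i,L]$. A graded ideal of $L$ is a $\mathbb{Z}_2$-graded subspace $I$ with $[I,L]\subseteq I$. A pair of Lie superalgebras $(N,L)$ is a Lie superalgebra $L$ together with a graded ideal $N$ of $L$. A complement of $N$ in $L$ is a sub-superalgebra $K$ of $L$ with $L=N\oplus K$ as superspaces. Put $Z(N,L)=\{n\in N\mid [n,x]=0\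 \text{for all } x\in L\}$. Schur multiplier: let $0\to R\to F\to L\to 0$ be a free presentation of $L$ (i.e. $F$ is a free Lie superalgebra, and $R$ is the kernel of a surjective homomorphism $F\to L$ of Lie superalgebras, homomorphisms being linear maps preserving degree and bracket), and let $S$ be the graded ideal of $F$ with $N\cong S/R$ (the preimage of $N$). Then $\mathcal{M}(N,L)=\dfrac{R\cap[S,F]}{[R,F]}$. This is an abelian Lie superalgebra, independent (up to isomorphism) of the choice of free presentation. Writing $\dim V=(m|n)$ for a superspace $V=V_0\oplus V_1$ means $\dim V_0=m$ and $\dim V_1=n$. In numerical formulas, $\dim V$ denotes the total dimension $\dim V_0+\dim V_1$ (so $\dim N$ in the formula is $m+n$). *)

(* Defs.v *)
From HB Require Import structures.
From mathcomp Require Import all_boot all_order all_algebra.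

Set Implicit Arguments.
Unset Strict Implicit.
Unset Printing Implicit Defensive.

Import GRing.Theory.
Local Open Scope ring_scope.

(* Degrees in Z/2 are booleans (false = even, true = odd), so that the product
   |x||y| of two degrees a and b is a && b, and their sum is a (+) b.
   homog a is the graded component V_a; homog_split and homog_direct express
   V = V_0 (+) V_1. *)
HB.mixin Record isLieSuperalgebra (K : fieldType) V of GRing.Lmodule K V := {
  homog : bool -> V -> Prop;
  homog0 : forall a, homog a 0;
  homogP : forall a (k : K) x y, homog a x -> homog a y -> homog a (k *: x + y);
  homog_split : forall x,
    exists x0 x1, [/\ homog false x0, homog true x1 & x = x0 + x1];
  homog_direct : forall x, homog false x -> homog true x -> x = 0;
  bracket : V -> V -> V;
  bracketPl : forall (k : K) x y z,
    bracket (k *: x + y) z = k *: bracket x z + bracket y z;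
  bracketPr : forall (k : K) x y z,
    bracket x (k *: y + z) = k *: bracket x y + bracket x z;
  bracket_homog : forall a b x y,
    homog a x -> homog b y -> homog (a (+) b) (bracket x y);
  bracket_anti : forall a b x y, homog a x -> homog b y ->
    bracket x y = - ((-1) ^+ (a && b) *: bracket y x);
  bracket_jacobi : forall a b c x y z,
    homog a x -> homog b y -> homog c z ->
    (-1) ^+ (a && c) *: bracket x (bracket y z)
    + (-1) ^+ (b && a) *: bracket y (bracket z x)
    + (-1) ^+ (c && b) *: bracket z (bracket x y) = 0
}.

#[short(type="lieSuperalgType")]
HB.structure Definition LieSuperalgebra (K : fieldType) :=
  {V of isLieSuperalgebra K V & GRing.Lmodule K V}.

#[short(type="vectLieSuperalgType")]
HB.structure Definition VectLieSuperalgebra (K : fieldType) :=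
  {V of isLieSuperalgebra K V & Vector K V}.

Section LieSuperalgebras.

Variable K : fieldType.

(* Free Lie superalgebras and their ideals are infinite dimensional; their
   subspaces are represented by Prop-valued predicates. *)
Definition bracket_span (V : lieSuperalgType K) (A B : V -> Prop) (x : V) : Prop :=
  exists (k : nat) (c : 'I_k -> K) (a b : 'I_k -> V),
    [/\ forall i, A (a i), forall i, B (b i)
      & x = \sum_(i < k) c i *: bracket (a i) (b i)].

(* For subspaces B <= A of V: the quotient A/B has a basis with d elements. *)
Definition quot_dim (V : lmodType K) (A B : V -> Prop) (d : nat) : Prop :=
  exists v : 'I_d -> V,
    [/\ forall i, A (v i),
        forall c : 'I_d -> K, B (\sum_(i < d) c i *: v i) -> forall i, c i = 0
      & forall x, A x -> exists c : 'I_d -> K, B (x - \sum_(i < d) c i *: v i)].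

Definition lie_hom (V W : lieSuperalgType K) (f : V -> W) : Prop :=
  [/\ linear f,
      forall a x, homog a x -> homog a (f x)
    & forall x y, f (bracket x y) = bracket (f x) (f y)].

(* F is free on the Z/2-graded set (X, deg) via the map iota. *)
Definition free_on (F : lieSuperalgType K) (X : Type) (deg : X -> bool)
    (iota : X -> F) : Prop :=
  (forall x, homog (deg x) (iota x)) /\
  forall (M : lieSuperalgType K) (f : X -> M),
    (forall x, homog (deg x) (f x)) ->
    exists phi : F -> M,
      [/\ lie_hom phi, forall x, phi (iota x) = f x
        & forall psi : F -> M, lie_hom psi ->
            (forall x, psi (iota x) = f x) -> psi =1 phi].

Definition is_free (F : lieSuperalgType K) : Prop :=
  exists (X : Type) (deg : X -> bool) (iota : X -> F), free_on deg iota.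

Definition free_presentation (F L : lieSuperalgType K) (pi : F -> L) : Prop :=
  [/\ is_free F, lie_hom pi & forall y, exists x, pi x = y].

Section FiniteDimensional.

Variable L : vectLieSuperalgType K.
Implicit Types U W N : {vspace L}.

(* Spanned by the brackets of basis vectors, like the product of subspaces of
   an algebra in falgebra; brvP shows that this is the span of all brackets. *)
Definition brv U W : {vspace L} :=
  <<[seq bracket x y | x <- vbasis U, y <- vbasis W]>>%VS.

Lemma brvP U W (x : L) :
  x \in brv U W <->
  bracket_span (fun u : L => u \in U) (fun w : L => w \in W) x.
Proof.
have b0l (y : L) : bracket 0 y = 0 :> L.
  by have := bracketPl (-1 : K) 0 0 y; rewrite !scaleN1r !addNr.
have b0r (y : L) : bracket y 0 = 0 :> L.
  by have := bracketPr (-1 : K) y 0 0; rewrite !scaleN1r !addNr.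
pose s := [seq (u, w) | u <- vbasis U, w <- vbasis W].
have sE : [seq bracket u w | u <- vbasis U, w <- vbasis W] =
          [seq bracket p.1 p.2 | p <- s].
  by rewrite /s map_allpairs.
split.
  rewrite /brv sE => /(@coord_span _ _ _ (in_tuple _)) xE.
  exists (size [seq bracket p.1 p.2 | p <- s]).
  exists (fun i => coord (in_tuple [seq bracket p.1 p.2 | p <- s]) i x).
  exists (fun i => (nth (0, 0) s i).1), (fun i => (nth (0, 0) s i).2).
  have mem_s (i : 'I_(size [seq bracket p.1 p.2 | p <- s])) :
      nth (0, 0) s i \in s.
    by apply: mem_nth; rewrite -(size_map (fun p => bracket p.1 p.2) s) ltn_ord.
  split.
  - move=> i; have /allpairsP[[u w] [/= hu _ ->]] := mem_s i.
    exact: vbasis_mem hu.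
  - move=> i; have /allpairsP[[u w] [/= _ hw ->]] := mem_s i.
    exact: vbasis_mem hw.
  - rewrite {1}xE; apply: eq_bigr => i _; congr (_ *: _).
    rewrite (nth_map (0, 0)) //.
    by rewrite -(size_map (fun p => bracket p.1 p.2) s) ltn_ord.
case=> k [c [a [b [ha hb ->]]]]; apply: memv_suml => i _; apply: memvZ.
rewrite (coord_vbasis (ha i)).
elim/big_rec: _ => [|j y _ IHy]; first by rewrite b0l mem0v.
rewrite bracketPl; apply: memvD => //; apply: memvZ.
rewrite (coord_vbasis (hb i)).
elim/big_rec: _ => [|l z _ IHz]; first by rewrite b0r mem0v.
rewrite bracketPr; apply: memvD => //; apply: memvZ.
apply: memv_span; apply/allpairsP; exists ((vbasis U)`_j, (vbasis W)`_l).
by split; rewrite ?mem_nth ?size_tuple ?ltn_ord.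
Qed.

(* lcs U i is the term U^(i+1) of the lower central series U^1 = U,
   U^(j+1) = [U^j, U]. *)
Definition lcs U (i : nat) : {vspace L} := iter i (fun W => brv W U) U.

Definition nilpotent_super U : Prop := exists i, lcs U i = 0%VS.

Definition abelian_super U : Prop :=
  forall x y : L, x \in U -> y \in U -> bracket x y = 0.

Definition graded U : Prop :=
  forall x : L, x \in U -> exists x0 x1 : L,
    [/\ x0 \in U /\ homog false x0, x1 \in U /\ homog true x1 & x = x0 + x1].

Definition superdim U (m n : nat) : Prop :=
  exists U0 U1 : {vspace L},
    [/\ forall x : L, x \in U0 <-> x \in U /\ homog false x,
        forall x : L, x \in U1 <-> x \in U /\ homog true x,
        \dim U0 = m & \dim U1 = n].

Definition graded_ideal U : Prop := graded U /\ (brv U {:L} <= U)%VS.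

Definition sub_superalgebra U : Prop := graded U /\ (brv U U <= U)%VS.

Definition is_complement N W : Prop :=
  [/\ sub_superalgebra W, (N + W)%VS = fullv & (N :&: W)%VS = 0%VS].

Definition pair_center N (z : L) : Prop :=
  z \in N /\ forall x : L, bracket z x = 0.

(* dim M(N, L) = d, computed from the free presentation pi : F -> L, as the
   dimension of (R :&: [S, F]) / [R, F] with R = ker pi and S = pi^-1(N). *)
Definition multiplier_dim (F : lieSuperalgType K) (pi : F -> L) N (d : nat) :
    Prop :=
  let R := fun x : F => pi x = 0 in
  let S := fun x : F => pi x \in N in
  let T := fun _ : F => True in
  quot_dim (fun x => R x /\ bracket_span S T x) (bracket_span R T) d.

End FiniteDimensional.

End LieSuperalgebras.

(* Main.v *)
Require Import Defs.
From HB Require Import structures.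
From mathcomp Require Import all_boot all_order all_algebra.
From mathcomp Require Import ring lra zify.

Set Implicit Arguments.
Unset Strict Implicit.
Unset Printing Implicit Defensive.

Import GRing.Theory.
Local Open Scope ring_scope.

(** Put [k = \dim N], [D = \dim L] and let [R] be the kernel of [pi] and [S] the
    preimage of [N].  Choose a homogeneous basis of [L] whose first [k] vectors
    form a basis of [N], and lift it to homogeneous elements [b i] of [F].
    Modulo [[R, F]] the bracket of [F] depends only on images in [L], so
    [[S, F] / [R, F]] is spanned by the basic brackets [[b i, b j]] with [i < k]
    and either [i < j] or [i = j] of odd degree (lemma [SF_basic_sum]).  There
    are [((m + n)^2 + (n - m)) / 2 + k * (D - k)] of them (lemma
    [card_basic_pairs]), which by hypothesis is [d + 1].

    On the other hand [[S, F] / [R, F]] has dimension [d + \dim [N, L]] (lemma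
    [multiplier_dim_SF]), hence [\dim [N, L] <= 1].  Suppose it is [1].  By
    nilpotency [[N, L]] is central (lemma [brv_line_central]), and the basic
    brackets are linearly independent modulo [[R, F]].  Let [z] in [N] be central
    and outside [[N, L]], and let [w] be a bracket spanning [[N, L]].  By the
    Jacobi identity, lifts of [z] and [w] commute modulo [[R, F]] (lemma
    [RF_central_bracket]); as [z] and [w] are independent, this is a nontrivial
    relation between basic brackets (lemma [commuting_relation]), a
    contradiction.  So [[N, L]] is the whole of [Z(N, L)].

    Finally, if [L] were abelian, then [[S, F]] would be contained in [R], and
    [d] would be the dimension of [[S, F] / [R, F]].  But [pi] lifts to a
    homomorphism from the free superalgebra [F] to an explicit superalgebra of
    class two over [L], which kills [[R, F]] and sends the basic brackets to
    independent elements (lemma [basic_indep]), so [d] would be at least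
    [d + 1]. *)

(** * Subspaces given by predicates, and dimension counting modulo a subspace *)

(** The subspaces of [V], which may be infinite dimensional, as predicates. *)
Definition is_subspace (K : fieldType) (V : lmodType K) (B : V -> Prop) :=
  B 0 /\ forall k x y, B x -> B y -> B (k *: x + y).

Section Subspaces.

Variables (K : fieldType) (V : lmodType K) (B : V -> Prop).
Hypothesis subB : is_subspace B.

Lemma subspace0 : B 0. Proof. exact: subB.1. Qed.

Lemma subspaceZ k x : B x -> B (k *: x).
Proof. by move=> Bx; rewrite -[_ *: _]addr0; apply: subB.2 => //; apply: subB.1. Qed.

Lemma subspaceD x y : B x -> B y -> B (x + y).
Proof. by move=> Bx By; rewrite -[x]scale1r; apply: subB.2. Qed.

Lemma subspaceN x : B x -> B (- x).
Proof. by rewrite -scaleN1r; apply: subspaceZ. Qed.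

Lemma subspaceB x y : B x -> B y -> B (x - y).
Proof. by move=> Bx /subspaceN; apply: subspaceD. Qed.

Lemma subspace_sum (I : Type) (r : seq I) (P : pred I) (f : I -> V) :
  (forall i, P i -> B (f i)) -> B (\sum_(i <- r | P i) f i).
Proof.
by move=> Bf; elim/big_rec: _ => [|i x Pi Bx];
  [apply: subspace0 | apply: subspaceD => //; apply: Bf].
Qed.

(** If [p] vectors are independent modulo [B] and lie in the span of [q]
    generators modulo [B], and the generators satisfy [r] independent relations
    modulo [B], then [p + r <= q]. *)
Lemma indep_mod_leq p q r (u : 'I_p -> V) (g : 'I_q -> V) (rel : 'M[K]_(r, q)) :
    (forall c : 'I_p -> K, B (\sum_i c i *: u i) -> forall i, c i = 0) ->
    (forall i, exists a : 'I_q -> K, B (u i - \sum_j a j *: g j)) ->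
    (forall i, B (\sum_j rel i j *: g j)) -> row_free rel ->
  (p + r <= q)%N.
Proof.
move=> indep gen Brel free_rel.
have [a Ba] := fin_all_exists gen.
pose A : 'M[K]_(p, q) := \matrix_(i, j) a i j.
suff: row_free (col_mx A rel).
  by rewrite -row_leq_rank => /leq_trans; apply; apply: rank_leq_col.
rewrite -kermx_eq0; apply/rowV0P => v; move/sub_kermxP.
rewrite -[v]hsubmxK mul_row_col; set v1 := lsubmx v; set v2 := rsubmx v.
move=> v_rel.
(* The combination of the generators with coefficients v1 *m A + v2 *m rel is
   zero, hence so is the combination v1 of the u i modulo B. *)
have v1_0 : v1 = 0.
  apply/rowP => i; rewrite [RHS]mxE; move: i; apply: (indep (fun i => v1 0 i)) => /=.
  have -> : \sum_i v1 0 i *: u i =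
      \sum_i v1 0 i *: (u i - \sum_j a i j *: g j)
      - \sum_i v2 0 i *: (\sum_j rel i j *: g j).
    under [X in _ = X - _]eq_bigr => i _ do rewrite scalerBr.
    rewrite sumrB -addrA -opprD [X in _ = _ - X](_ : _ = 0) ?subr0 //.
    have comb m (w : 'rV[K]_m) (M : 'M[K]_(m, q)) (f : 'I_m -> 'I_q -> K) :
        (forall i j, M i j = f i j) ->
        \sum_i w 0 i *: (\sum_j f i j *: g j) = \sum_j (w *m M) 0 j *: g j.
      move=> Mf; under eq_bigr => i _ do rewrite scaler_sumr.
      rewrite exchange_big /=; apply: eq_bigr => j _.
      rewrite mxE scaler_suml; apply: eq_bigr => i _.
      by rewrite scalerA Mf.
    rewrite (comb _ v1 A) ?(comb _ v2 rel) //; last by move=> i j; rewrite mxE.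
    rewrite -big_split big1 //= => j _.
    have /rowP/(_ j) := v_rel; rewrite [LHS]mxE [RHS]mxE => v_rel_j.
    by rewrite -scalerDl v_rel_j scale0r.
  by apply: subspaceB; apply: subspace_sum => i _; apply: subspaceZ.
move: v_rel; rewrite v1_0 mul0mx add0r => /eqP.
by rewrite mulmx_free_eq0 // => /eqP ->; rewrite row_mx0.
Qed.

End Subspaces.

(** * Brackets, homogeneous components and spans of brackets *)

Section Brackets.

Variables (K : fieldType) (V : lieSuperalgType K).
Implicit Types (x y z : V) (A B Q : V -> Prop).

Lemma homogZ a (k : K) x : homog a x -> homog a (k *: x).
Proof. by move=> hx; rewrite -[_ *: _]addr0; apply: homogP => //; apply: homog0. Qed.

Lemma homogN a x : homog a x -> homog a (- x).
Proof. by rewrite -scaleN1r; apply: homogZ. Qed.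

Lemma homogD a x y : homog a x -> homog a y -> homog a (x + y).
Proof. by move=> hx hy; rewrite -[x]scale1r; apply: homogP. Qed.

Lemma homog_sum a (I : Type) (r : seq I) (P : pred I) (f : I -> V) :
  (forall i, P i -> homog a (f i)) -> homog a (\sum_(i <- r | P i) f i).
Proof.
by move=> hf; elim/big_rec: _ => [|i x Pi hx];
  [apply: homog0 | apply: homogD => //; apply: hf].
Qed.

Lemma homog_eq0 a x : homog a x -> homog (~~ a) x -> x = 0.
Proof. by case: a => h1 h2; apply: homog_direct. Qed.

Lemma bracket0l y : bracket 0 y = 0 :> V.
Proof. by have := bracketPl (-1 : K) 0 0 y; rewrite !scaleN1r !addNr. Qed.

Lemma bracket0r x : bracket x 0 = 0 :> V.
Proof. by have := bracketPr (-1 : K) x 0 0; rewrite !scaleN1r !addNr. Qed.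

Lemma bracketZl (k : K) x y : bracket (k *: x) y = k *: bracket x y.
Proof. by rewrite -[k *: x]addr0 bracketPl bracket0l addr0. Qed.

Lemma bracketZr (k : K) x y : bracket x (k *: y) = k *: bracket x y.
Proof. by rewrite -[k *: y]addr0 bracketPr bracket0r addr0. Qed.

Lemma bracketDl x y z : bracket (x + y) z = bracket x z + bracket y z.
Proof. by rewrite -[x in LHS](scale1r x) bracketPl scale1r. Qed.

Lemma bracketDr x y z : bracket x (y + z) = bracket x y + bracket x z.
Proof. by rewrite -[y in LHS](scale1r y) bracketPr scale1r. Qed.

Lemma bracket_suml (I : Type) (r : seq I) (P : pred I) (f : I -> V) y :
  bracket (\sum_(i <- r | P i) f i) y = \sum_(i <- r | P i) bracket (f i) y.
Proof.
by apply: (big_morph (bracket^~ y) _ (bracket0l y)) => u v; apply: bracketDl.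
Qed.

Lemma bracket_sumr (I : Type) (r : seq I) (P : pred I) (f : I -> V) x :
  bracket x (\sum_(i <- r | P i) f i) = \sum_(i <- r | P i) bracket x (f i).
Proof.
by apply: (big_morph (bracket x) _ (bracket0r x)) => u v; apply: bracketDr.
Qed.

Lemma bracket_anti_eq0 a b x y :
  homog a x -> homog b y -> bracket x y = 0 -> bracket y x = 0.
Proof.
by move=> hx hy xy0; rewrite (bracket_anti _ _ _ _ hy hx) xy0 scaler0 oppr0.
Qed.

Lemma bracket_span_gen A B x y : A x -> B y -> bracket_span A B (bracket x y).
Proof.
move=> Ax By; exists 1%N, (fun=> 1), (fun=> x), (fun=> y); split=> //.
by rewrite big_ord1 scale1r.
Qed.

Lemma bracket_span_subspace A B : is_subspace (bracket_span A B).
Proof.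
split.
  exists 0%N, (fun=> 0), (fun=> 0), (fun=> 0).
  by split=> [[]|[]|] //; rewrite big_ord0.
move=> k x y [p [c [a [b [Aa Bb ->]]]]] [q [c' [a' [b' [Aa' Bb' ->]]]]].
pose glue T (f : 'I_p -> T) (f' : 'I_q -> T) (i : 'I_(p + q)) :=
  match split i with inl j => f j | inr j => f' j end.
exists (p + q)%N, (glue _ (fun i => k * c i) c'), (glue _ a a'), (glue _ b b').
split=> [i|i|]; rewrite /glue; try by case: (split i).
rewrite big_split_ord /= scaler_sumr; congr (_ + _); apply: eq_bigr => i _.
  by rewrite (unsplitK (inl i)) scalerA.
by rewrite (unsplitK (inr i)).
Qed.

Lemma bracket_span_min A B Q : is_subspace Q ->
    (forall x y, A x -> B y -> Q (bracket x y)) ->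
  forall x, bracket_span A B x -> Q x.
Proof.
move=> subQ AB_Q x [k [c [a [b [Aa Bb ->]]]]].
by apply: subspace_sum => // i _; apply: subspaceZ => //; apply: AB_Q.
Qed.

End Brackets.

Section Homomorphisms.

Variables (K : fieldType) (V W : lieSuperalgType K) (f : V -> W).
Hypothesis hom_f : lie_hom f.

Lemma lie_homPZ (k : K) x y : f (k *: x + y) = k *: f x + f y.
Proof. by case: hom_f => lf _ _; apply: lf. Qed.

Lemma lie_hom_homog a x : homog a x -> homog a (f x).
Proof. by case: hom_f => _ + _; apply. Qed.

Lemma lie_homM x y : f (bracket x y) = bracket (f x) (f y).
Proof. by case: hom_f. Qed.

Lemma lie_homD x y : f (x + y) = f x + f y.
Proof. by rewrite -[x in LHS]scale1r lie_homPZ scale1r. Qed.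

Lemma lie_hom0 : f 0 = 0.
Proof. by have := lie_homPZ (-1) 0 0; rewrite !scaleN1r !addNr. Qed.

Lemma lie_homZ (k : K) x : f (k *: x) = k *: f x.
Proof. by rewrite -[k *: x]addr0 lie_homPZ lie_hom0 addr0. Qed.

Lemma lie_homB x y : f (x - y) = f x - f y.
Proof. by rewrite lie_homD -!scaleN1r lie_homZ. Qed.

Lemma lie_hom_sum (I : Type) (r : seq I) (P : pred I) (g : I -> V) :
  f (\sum_(i <- r | P i) g i) = \sum_(i <- r | P i) f (g i).
Proof. exact: (big_morph f lie_homD lie_hom0). Qed.

Lemma ker_subspace : is_subspace (fun x => f x = 0).
Proof.
by split=> [|k x y fx fy]; rewrite ?lie_hom0 // lie_homPZ fx fy scaler0 addr0.
Qed.

(** The kernel of a homomorphism is graded: the homogeneous components of the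
    image of [x] are the images of those of [x]. *)
Lemma ker_split x : f x = 0 ->
  exists x0 x1, [/\ homog false x0, homog true x1, f x0 = 0, f x1 = 0
                  & x = x0 + x1].
Proof.
have [x0 [x1 [h0 h1 ->]]] := homog_split x.
rewrite lie_homD => /eqP; rewrite addr_eq0 => /eqP f01.
have f0 : f x0 = 0.
  apply: homog_direct; first exact: lie_hom_homog.
  by rewrite f01; apply/homogN/lie_hom_homog.
exists x0, x1; split=> //.
by apply: oppr_inj; rewrite -f01 f0 oppr0.
Qed.

(** By super-antisymmetry, [[V, R]] is contained in [[R, V]] for [R] the kernel. *)
Lemma bracket_kerr x y : f y = 0 ->
  bracket_span (fun x => f x = 0) (fun=> True) (bracket x y).
Proof.
have [x0 [x1 [hx0 hx1 ->]]] := homog_split x.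
move=> /ker_split [y0 [y1 [hy0 hy1 fy0 fy1 ->]]].
have sub := @bracket_span_subspace K V (fun x => f x = 0) (fun=> True).
have swap a b u v : homog a u -> homog b v -> f v = 0 ->
    bracket_span (fun x => f x = 0) (fun=> True) (bracket u v).
  move=> hu hv fv; rewrite (bracket_anti _ _ _ _ hu hv).
  by apply/(subspaceN sub)/(subspaceZ sub)/bracket_span_gen.
rewrite bracketDl !bracketDr.
by do 2!apply: (subspaceD sub);
  [exact: swap hx0 hy0 _ | exact: swap hx0 hy1 _
  |exact: swap hx1 hy0 _ | exact: swap hx1 hy1 _].
Qed.

Lemma lift_homog a y :
  (exists x, f x = y) -> homog a y -> exists2 x, homog a x & f x = y.
Proof.
move=> [x <-]; have [x0 [x1 [h0 h1 ->]]] := homog_split x.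
rewrite lie_homD => hf.
have [f0 f1] := (lie_hom_homog h0, lie_hom_homog h1).
case: a hf => hf.
  exists x1 => //; rewrite [f x0](_ : _ = 0) ?add0r //.
  apply: homog_direct => //; rewrite -[f x0](addrK (f x1)).
  exact/homogD/homogN.
exists x0 => //; rewrite [f x1](_ : _ = 0) ?addr0 //.
apply: homog_direct => //; rewrite -[f x1](addKr (f x0)).
by apply: homogD => //; apply: homogN.
Qed.

End Homomorphisms.

(** * Homogeneous bases adapted to a graded ideal *)

Section AdaptedBasis.

Variables (K : fieldType) (L : vectLieSuperalgType K).
Implicit Types (U N : {vspace L}).

Lemma graded_split U : graded U ->
  exists U0 U1 : {vspace L},
    [/\ forall x, x \in U0 -> homog false x,
        forall x, x \in U1 -> homog true x & (U0 + U1)%VS = U].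
Proof.
move=> grU.
have split_basis (i : 'I_(\dim U)) : exists y : L * L,
    [/\ y.1 \in U /\ homog false y.1, y.2 \in U /\ homog true y.2
      & (vbasis U)`_i = y.1 + y.2].
  have [|x0 [x1 [h0 h1 ->]]] := grU (vbasis U)`_i; last by exists (x0, x1).
  by apply: vbasis_mem; rewrite mem_nth ?size_tuple.
have [y hy] := fin_all_exists split_basis.
pose T (b : bool) := [seq (if b then (y i).2 else (y i).1) | i <- enum 'I_(\dim U)].
have homT b x : x \in <<T b>>%VS -> homog b x.
  move=> /(@coord_span _ _ _ (in_tuple _)) ->.
  apply: homog_sum => i _; apply: homogZ.
  have /mapP[j _ ->] : (T b)`_i \in T b by apply: mem_nth.
  by case: b i; have [[_ ?] [_ ?] _] := hy j.
exists <<T false>>%VS, <<T true>>%VS; split; [exact: homT | exact: homT |].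
have memT b i : (if b then (y i).2 else (y i).1) \in <<T b>>%VS.
  by apply/memv_span/mapP; exists i; rewrite ?mem_enum.
apply/eqP; rewrite eqEsubv subv_add; apply/andP; split.
  apply/andP; split; apply/span_subvP => x /mapP[i _ ->];
  by have [[? _] [? _] _] := hy i.
apply/subvP => x xU; rewrite (coord_vbasis xU).
apply: memv_suml => i _; apply: memvZ; have [_ _ ->] := hy i.
by apply: memv_add; [apply: (memT false) | apply: (memT true)].
Qed.

(** A basis of [L] made of homogeneous vectors, of degrees [adapted_deg], the
    first [\dim N] of which form a basis of [N]; the last condition is expressed
    by coordinates. *)
Record adapted_basis N := AdaptedBasis {
  adapted_vec : (\dim {:L}).-tuple L;
  adapted_deg : 'I_(\dim {:L}) -> bool;
  adapted_basisP : basis_of fullv adapted_vec;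
  adapted_homog : forall i, homog (adapted_deg i) (adapted_vec`_i : L);
  adapted_memP : forall x : L,
    x \in N <-> (forall i : 'I_(\dim {:L}),
      (\dim N <= i)%N -> coord adapted_vec i x = 0)
}.

Lemma homog_directv (U0 U1 : {vspace L}) :
    (forall x, x \in U0 -> homog false x) ->
    (forall x, x \in U1 -> homog true x) ->
  directv (U0 + U1).
Proof.
move=> h0 h1; apply/directv_addP/eqP; rewrite -subv0.
apply/subvP => x; rewrite memv_cap => /andP[/h0 x0 /h1 x1].
by rewrite (homog_direct _ x0 x1) mem0v.
Qed.

Lemma adapted_basis_exists N m n :
    graded N -> (exists W : {vspace L}, is_complement N W) -> superdim N m n ->
  exists X : adapted_basis N,
    (\sum_(i < \dim {:L} | (i < \dim N)%N) adapted_deg X i = n)%N /\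
    (\dim N = m + n)%N.
Proof.
move=> grN [W [[grW _] NW NW0]] [U0 [U1 [U0P U1P dim0 dim1]]].
have h0 x : x \in U0 -> homog false x by case/U0P.
have h1 x : x \in U1 -> homog true x by case/U1P.
have UN : (U0 + U1)%VS = N.
  apply/eqP; rewrite eqEsubv subv_add; apply/andP; split.
    by apply/andP; split; apply/subvP => x; [case/U0P | case/U1P].
  apply/subvP => x /grN[x0 [x1 [? ? ->]]].
  by apply: memv_add; [apply/U0P | apply/U1P].
have [W0 [W1 [k0 k1 UW]]] := graded_split grW.
have dirN := homog_directv h0 h1; have dirW := homog_directv k0 k1.
pose tag (b : bool) (U : {vspace L}) := [seq (x, b) | x <- vbasis U].
pose tN := tag false U0 ++ tag true U1.
pose t := tN ++ (tag false W0 ++ tag true W1).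
have untag b U : [seq p.1 | p <- tag b U] = vbasis U.
  by rewrite -map_comp map_id.
have basN : basis_of N [seq p.1 | p <- tN].
  by rewrite map_cat !untag -UN; apply: cat_basis (vbasisP _) (vbasisP _).
have bast : basis_of fullv [seq p.1 | p <- t].
  rewrite map_cat -NW; apply: cat_basis basN _; first exact/directv_addP.
  by rewrite map_cat !untag -UW; apply: cat_basis (vbasisP _) (vbasisP _).
have sztN : size tN = \dim N by rewrite (size_basis (X := in_tuple _) basN) size_map.
have szt : size t = \dim {:L} by rewrite (size_basis (X := in_tuple _) bast) size_map.
have sz : size [seq p.1 | p <- t] == \dim {:L} by rewrite size_map szt.
have homt i : (i < size t)%N ->
    homog (nth (0, false) t i).2 ([seq p.1 | p <- t]`_i : L).
  move=> lt_i; rewrite (nth_map (0, false)) //.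
  have := mem_nth (0, false) lt_i; rewrite !mem_cat.
  by case/orP => /orP[] /mapP[x /vbasis_mem xU ->] /=;
    [exact: h0 | exact: h1 | exact: k0 | exact: k1].
have nthN i : (i < \dim N)%N ->
    [seq p.1 | p <- t]`_i = [seq p.1 | p <- tN]`_i.
  by move=> lt_i; rewrite [X in X`_i]map_cat nth_cat size_map sztN lt_i.
pose X := Tuple sz.
have freeX : free X by exact: basis_free bast.
have memX (x : L) :
    x \in N <-> (forall i : 'I_(\dim {:L}), (\dim N <= i)%N -> coord X i x = 0).
  split=> [xN i le_i|x0].
    have szN : size [seq p.1 | p <- tN] == \dim N by rewrite size_map sztN.
    rewrite (coord_basis (X := Tuple szN) basN xN) linear_sum big1 //= => j _.
    have lt_j : (j < \dim {:L})%N.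
      by rewrite (leq_trans (ltn_ord j)) // dimvS ?subvf.
    rewrite linearZ /= (_ : [seq p.1 | p <- tN]`_j = X`_(Ordinal lt_j)).
      rewrite coord_free // -val_eqE /= ltn_eqF ?mulr0 //.
      exact: leq_trans (ltn_ord j) le_i.
    by rewrite /= nthN.
  rewrite (coord_basis (X := X) bast (memvf x)).
  apply: memv_suml => i _; have [lt_i|le_i] := ltnP i (\dim N); last first.
    by rewrite x0 // scale0r mem0v.
  apply: memvZ; rewrite /= nthN //.
  by apply: (basis_mem basN); rewrite mem_nth // size_map sztN.
have homX i : homog (nth (0, false) t (i : 'I_(\dim {:L}))).2 (X`_i : L).
  by apply: homt; rewrite szt.
pose deg (i : 'I_(\dim {:L})) := (nth (0 : L, false) t i).2.
exists (@AdaptedBasis N X deg bast homX memX); split=> /=.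
  have leND : (\dim N <= \dim {:L})%N by rewrite dimvS ?subvf.
  rewrite -(big_ord_widen _ (fun i => nat_of_bool (nth (0 : L, false) t i).2) leND).
  rewrite (eq_bigr (fun i : 'I_(\dim N) => nat_of_bool (nth (0 : L, false) tN i).2)).
    rewrite -(big_mkord xpredT (fun i => nat_of_bool (nth (0 : L, false) tN i).2)).
    rewrite -sztN -(big_nth _ xpredT (fun p => nat_of_bool p.2)).
    rewrite big_cat /= !big_map /= big1_eq add0n sum1_size size_tuple.
    by rewrite dim1.
  by move=> i _; rewrite nth_cat sztN ltn_ord.
by rewrite -UN (directvP dirN) /= dim0 dim1.
Qed.

End AdaptedBasis.

(** * The pairs indexing the basic brackets *)

(** For homogeneous [b 0, .., b (D - 1)] of degrees [deg], the brackets
    [[b i, b j]] with [(i, j)] in this set span, by super-antisymmetry, all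
    brackets [[b i, b j]] with [i < k]; in odd degree the squares [[b i, b i]]
    have to be included, while in even degree they vanish if 2 is invertible. *)
Definition basic_pairs D k (deg : 'I_D -> bool) : {set 'I_D * 'I_D} :=
  [set p : 'I_D * 'I_D | (p.1 < k)%N && ((p.1 < p.2)%N || ((p.1 == p.2) && deg p.1))].

Lemma card_basic_pairs D k (deg : 'I_D -> bool) : (k <= D)%N ->
  (2 * #|basic_pairs k deg| + k * k + k
   = 2 * k * D + 2 * \sum_(i < D | (i < k)%N) deg i)%N.
Proof.
move=> le_kD.
have row_sum (i : nat) (E : nat) : (\sum_(j < E) (i < j) = E - i.+1)%N.
  by elim: E => [|E IH]; rewrite ?big_ord0 // big_ord_recr /= IH; lia.
have tri : (2 * (\sum_(i < D | (i < k)%N) (D - i.+1)) + k * k + k = 2 * k * D)%N.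
  rewrite -(big_ord_widen _ (fun i => D - i.+1)%N le_kD).
  elim: k le_kD => [|k IH] lt_kD; first by rewrite big_ord0; lia.
  rewrite big_ord_recr /=; have := IH (ltnW lt_kD).
  move: (\sum_(i < k) _)%N => S; rewrite -(subnK lt_kD); nia.
have -> : (#|basic_pairs k deg| =
    \sum_(i < D | (i < k)%N) (D - i.+1) + \sum_(i < D | (i < k)%N) deg i)%N.
  rewrite -sum1_card -big_split /=.
  rewrite (eq_bigl (fun p : 'I_D * 'I_D => (p.1 < k)%N &&
    ((p.1 < p.2)%N || ((p.1 == p.2) && deg p.1)))); last by move=> p; rewrite inE.
  rewrite -(pair_big_dep (fun i : 'I_D => (i < k)%N)
    (fun i j : 'I_D => (i < j)%N || ((i == j) && deg i)) (fun _ _ => 1%N)) /=.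
  apply: eq_bigr => i _; rewrite -row_sum big_mkcond /=.
  rewrite (bigD1 i) //= [in RHS](bigD1 i) //= ltnn eqxx add0n addnC /=.
  congr (_ + _)%N.
  by apply: eq_bigr => j /negPf; rewrite eq_sym => ->; rewrite orbF; case: ltnP.
lia.
Qed.

(** * A superalgebra of nilpotency class two *)

(** Let [V] be the superspace with a basis [e i] of degrees [deg]. This is the
    superspace of pairs of a vector of [V] (its coordinates) and a square matrix,
    where the elementary matrix [E i j] has degree [deg i + deg j]. With the
    bracket below, which on basis vectors is
    [[e i, e j] = E i j - (-1)^(deg i * deg j) E j i] with values in the central
    subspace of matrices, the subalgebra generated by [V] is [V] plus its
    (super) exterior square when 2 is invertible: the free superalgebra of class
    two on [V]. *)
Definition class2 (K : fieldType) D (deg : 'I_D -> bool) : Type :=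
  ('rV[K]_D * 'M[K]_D)%type.

HB.instance Definition _ K D (deg : 'I_D -> bool) :=
  GRing.Lmodule.copy (class2 K deg) ('rV[K]_D * 'M[K]_D)%type.

Section Class2.

Variables (K : fieldType) (D : nat) (deg : 'I_D -> bool).
Let H := class2 K deg.
Implicit Types x y z : H.

(** The matrix part of the bracket of two vectors of [V]. *)
Definition wedge (u v : 'rV[K]_D) : 'M[K]_D :=
  \matrix_(i, j) (u 0 i * v 0 j - (-1) ^+ (deg i && deg j) * (v 0 i * u 0 j)).

Definition class2_bracket x y : H := (0, wedge x.1 y.1).

(** The component of degree [a]. *)
Definition class2_homog (a : bool) x : Prop :=
  (forall i, deg i != a -> x.1 0 i = 0) /\
  (forall i j, deg i (+) deg j != a -> x.2 i j = 0).

Lemma wedge0r u : wedge u 0 = 0.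
Proof. by apply/matrixP => i j; rewrite !mxE; ring. Qed.

Lemma wedge0l u : wedge 0 u = 0.
Proof. by apply/matrixP => i j; rewrite !mxE; ring. Qed.

Lemma class2_ext x y : x.1 = y.1 -> x.2 = y.2 -> x = y.
Proof. by case: x y => [u A] [v B] /= -> ->. Qed.

Lemma class2_homog0 a : class2_homog a 0.
Proof. by split=> *; rewrite !mxE. Qed.

Lemma class2_homogP a (k : K) x y :
  class2_homog a x -> class2_homog a y -> class2_homog a (k *: x + y).
Proof.
case=> [x1 x2] [y1 y2].
by split=> *; rewrite !mxE ?x1 ?x2 ?y1 ?y2 ?mulr0 ?addr0.
Qed.

Lemma class2_homog_split x :
  exists x0 x1, [/\ class2_homog false x0, class2_homog true x1 & x = x0 + x1].
Proof.
pose part a : H := (\row_i (if deg i == a then x.1 0 i else 0),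
                    \matrix_(i, j) (if deg i (+) deg j == a then x.2 i j else 0)).
have hpart a : class2_homog a (part a).
  by split=> *; rewrite mxE ifN_eq.
exists (part false), (part true); split=> //.
case: x @part {hpart} => u A /=; congr (_, _).
  by apply/rowP => i; rewrite !mxE; case: (deg i); rewrite ?addr0 ?add0r.
by apply/matrixP => i j; rewrite !mxE; case: (_ (+) _); rewrite ?addr0 ?add0r.
Qed.

Lemma class2_homog_direct x : class2_homog false x -> class2_homog true x -> x = 0.
Proof.
case: x => u A [/= u0 A0] [/= u1 A1]; congr (_, _).
  by apply/rowP => i; rewrite mxE; case di: (deg i); [apply: u0 | apply: u1]; rewrite di.
by apply/matrixP => i j; rewrite mxE; case di: (deg i (+) deg j);
  [apply: A0 | apply: A1]; rewrite di.
Qed.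

Lemma class2_bracketPl (k : K) x y z :
  class2_bracket (k *: x + y) z = k *: class2_bracket x z + class2_bracket y z.
Proof.
apply: class2_ext; first by rewrite /= scaler0 addr0.
by apply/matrixP => i j; rewrite !mxE; ring.
Qed.

Lemma class2_bracketPr (k : K) x y z :
  class2_bracket x (k *: y + z) = k *: class2_bracket x y + class2_bracket x z.
Proof.
apply: class2_ext; first by rewrite /= scaler0 addr0.
by apply/matrixP => i j; rewrite !mxE; ring.
Qed.

Lemma class2_bracket_homog a b x y : class2_homog a x -> class2_homog b y ->
  class2_homog (a (+) b) (class2_bracket x y).
Proof.
case=> x1 _ [y1 _]; split=> [i _|i j] /=; rewrite !mxE // => dij.
have vanish (u v : bool) (s t : 'rV[K]_D) :
    (forall i, deg i != u -> s 0 i = 0) -> (forall i, deg i != v -> t 0 i = 0) ->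
    u (+) v = a (+) b -> s 0 i * t 0 j = 0.
  move=> s0 t0 uv; have [di|/s0 ->] := eqVneq (deg i) u; last by rewrite mul0r.
  have [dj|/t0 ->] := eqVneq (deg j) v; last by rewrite mulr0.
  by case/eqP: dij; rewrite di dj.
by rewrite (vanish a b) // (vanish b a) ?mulr0 ?subr0 // addbC.
Qed.

Lemma class2_bracket_anti a b x y : class2_homog a x -> class2_homog b y ->
  class2_bracket x y = - ((-1) ^+ (a && b) *: class2_bracket y x).
Proof.
case=> x1 _ [y1 _]; apply: class2_ext; first by rewrite /= scaler0 oppr0.
apply/matrixP => i j; rewrite !mxE.
have vanish (u v : bool) (s t : 'rV[K]_D) :
    (forall i, deg i != u -> s 0 i = 0) -> (forall i, deg i != v -> t 0 i = 0) ->
    u && v = a && b ->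
    s 0 i * t 0 j = (-1) ^+ (a && b) * ((-1) ^+ (deg i && deg j) * (s 0 i * t 0 j)).
  move=> s0 t0 uv; have [di|/s0 ->] := eqVneq (deg i) u; last by rewrite mul0r !mulr0.
  have [dj|/t0 ->] := eqVneq (deg j) v; last by rewrite !mulr0.
  by rewrite di dj uv mulrA -expr2 sqrr_sign mul1r.
rewrite [in LHS](vanish a b) // [in RHS](vanish b a) //; last by rewrite andbC.
have /eqP := sqrr_sign K (a && b); have /eqP := sqrr_sign K (deg i && deg j).
move: ((-1) ^+ _) ((-1) ^+ _) => s t /eqP s2 /eqP t2.
rewrite mulrBr !mulrA -!expr2 ?s2 ?t2.
ring.
Qed.

Lemma class2_jacobi (a b c : bool) x y z :
  (-1) ^+ (a && c) *: class2_bracket x (class2_bracket y z)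
  + (-1) ^+ (b && a) *: class2_bracket y (class2_bracket z x)
  + (-1) ^+ (c && b) *: class2_bracket z (class2_bracket x y) = 0 :> H.
Proof.
have triv u v w : class2_bracket u (class2_bracket v w) = 0.
  by rewrite /class2_bracket /= wedge0r.
by rewrite !triv !scaler0 !addr0.
Qed.

HB.instance Definition _ := isLieSuperalgebra.Build K (class2 K deg)
  class2_homog0 class2_homogP class2_homog_split class2_homog_direct
  class2_bracketPl class2_bracketPr class2_bracket_homog class2_bracket_anti
  (fun a b c x y z _ _ _ => class2_jacobi a b c x y z).

End Class2.

(** * The basic brackets span [[S, F]] modulo [[R, F]] *)

(** The coefficient of the basic bracket of index [p] in the bracket of the
    vectors with coordinates [x] and [y]. *)
Definition basic_coef (K : fieldType) D (deg : 'I_D -> bool) (x y : 'I_D -> K)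
    (p : 'I_D * 'I_D) : K :=
  if p.1 == p.2 then x p.1 * y p.1
  else x p.1 * y p.2 - (-1) ^+ (deg p.1 && deg p.2) * (x p.2 * y p.1).

(** Expansion of a bracket in the basic ones.  The coefficients [x i] vanish for
    [k <= i], that is, the left argument is in the span of the first [k]
    vectors. *)
Lemma bracket_basic_sum (K : fieldType) (V : lieSuperalgType K) D k
    (deg : 'I_D -> bool) (b : 'I_D -> V) (x y : 'I_D -> K) :
    2%:R != 0 :> K -> (forall i, homog (deg i) (b i)) ->
    (forall i : 'I_D, (k <= i)%N -> x i = 0) ->
  bracket (\sum_i x i *: b i) (\sum_i y i *: b i) =
  \sum_(p in basic_pairs k deg) basic_coef deg x y p *: bracket (b p.1) (b p.2).
Proof.
move=> nz2 hb x0.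
pose f i j := (x i * y j) *: bracket (b i) (b j).
pose h i j := if (i, j) \in basic_pairs k deg
              then basic_coef deg x y (i, j) *: bracket (b i) (b j) else 0.
have -> : bracket (\sum_i x i *: b i) (\sum_i y i *: b i) = \sum_i \sum_j f i j.
  rewrite bracket_suml; apply: eq_bigr => i _.
  rewrite bracket_sumr; apply: eq_bigr => j _.
  by rewrite bracketZl bracketZr scalerA.
have -> : \sum_(p in basic_pairs k deg)
            basic_coef deg x y p *: bracket (b p.1) (b p.2) = \sum_i \sum_j h i j.
  by rewrite big_mkcond pair_big /=; apply: eq_bigr => -[i j].
(* Both double sums have the same symmetrization, and 2 is invertible. *)
have sym i j : f i j + f j i = h i j + h j i.
  wlog lt_ij : i j / (i <= j)%N.
    move=> IH; case/orP: (leq_total i j) => [/IH //|/IH E].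
    by rewrite addrC E addrC.
  rewrite /h !inE /=; have [eq_ij|ne_ij] := eqVneq i j.
    rewrite -eq_ij ltnn /= /f /basic_coef /= eqxx.
    have [lt_i|/x0 ->] := ltnP i k; last by rewrite !mul0r scale0r.
    case di: (deg i) => //=; suff -> : bracket (b i) (b i) = 0 by rewrite scaler0.
    have := bracket_anti _ _ _ _ (hb i) (hb i); rewrite di expr0 scale1r.
    move=> /eqP; rewrite -addr_eq0 -mulr2n -scaler_nat scaler_eq0.
    by rewrite (negPf nz2) => /eqP.
  rewrite /= !orbF.
  have -> : (j < i)%N = false by apply/negbTE; rewrite -leqNgt.
  have -> : (i < j)%N by rewrite ltn_neqAle lt_ij andbT.
  rewrite andbF andbT addr0 /f /basic_coef /= (negPf ne_ij).
  have [lt_i|le_i] := ltnP i k; last first.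
    by rewrite (x0 i) // (x0 j) ?(leq_trans le_i) // !mul0r !scale0r addr0.
  rewrite (bracket_anti _ _ _ _ (hb j) (hb i)) andbC.
  by rewrite scalerN scalerA -scalerBl; congr (_ *: _); ring.
have dblE (q : 'I_D -> 'I_D -> V) :
    (\sum_i \sum_j q i j) *+ 2 = \sum_i \sum_j (q i j + q j i).
  rewrite mulr2n [X in _ + X]exchange_big -big_split /=.
  by apply: eq_bigr => i _; rewrite -big_split.
have dbl : (\sum_i \sum_j f i j) *+ 2 = (\sum_i \sum_j h i j) *+ 2.
  rewrite !dblE; apply: eq_bigr => i _; apply: eq_bigr => j _; exact: sym.
apply/eqP; rewrite -subr_eq0; move/eqP: dbl.
by rewrite -subr_eq0 -mulrnBl -scaler_nat scaler_eq0 (negPf nz2).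
Qed.

Section Presentation.

Variables (K : fieldType) (L : vectLieSuperalgType K) (N : {vspace L}).
Variables (X : adapted_basis N) (F : lieSuperalgType K) (pi : F -> L).
(* Homogeneous lifts to F of the vectors of the adapted basis. *)
Variable b : 'I_(\dim {:L}) -> F.
Hypothesis nz2 : 2%:R != 0 :> K.
Hypothesis hom_pi : lie_hom pi.
Hypothesis surj_pi : forall y, exists x, pi x = y.
Hypothesis homog_b : forall i, homog (adapted_deg X i) (b i).
Hypothesis pi_b : forall i, pi (b i) = (adapted_vec X)`_i.

Let D := \dim {:L}.
Let k := \dim N.
Let deg := adapted_deg X.
Let crd (x : F) (i : 'I_D) : K := coord (adapted_vec X) i (pi x).
Let RF := bracket_span (fun x : F => pi x = 0) (fun=> True).
Let SF := bracket_span (fun x : F => pi x \in N) (fun=> True).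
Let P := basic_pairs k deg.
Let g (j : 'I_#|P|) : F := bracket (b (enum_val j).1) (b (enum_val j).2).

Let subRF : is_subspace RF. Proof. exact: bracket_span_subspace. Qed.

Lemma coord_adapted_vec (i j : 'I_D) :
  coord (adapted_vec X) i (adapted_vec X)`_j = (j == i)%:R.
Proof. by rewrite coord_free // (basis_free (adapted_basisP X)). Qed.

Lemma adapted_vec_mem (i : 'I_D) : (i < k)%N -> (adapted_vec X)`_i \in N.
Proof.
move=> lt_i; apply/(adapted_memP X) => j le_j.
by rewrite coord_adapted_vec -val_eqE /= ltn_eqF // (leq_trans lt_i).
Qed.

Lemma adapted_eq (x : L) :
  x = \sum_i coord (adapted_vec X) i x *: (adapted_vec X)`_i.
Proof. exact: coord_basis (adapted_basisP X) (memvf x). Qed.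

Lemma RF_bracket_cong (x x' y y' : F) : pi x = pi x' -> pi y = pi y' ->
  RF (bracket x y - bracket x' y').
Proof.
move=> xx' yy'; rewrite -[bracket x y](subrK (bracket x' y)) -addrA.
apply: subspaceD => //.
  rewrite (_ : _ - _ = bracket (x - x') y); last first.
    by rewrite bracketDl -!scaleN1r bracketZl.
  by apply: bracket_span_gen => //; rewrite lie_homB // xx' subrr.
rewrite (_ : _ - _ = bracket x' (y - y')); last first.
  by rewrite bracketDr -!scaleN1r bracketZr.
by apply: bracket_kerr => //; rewrite lie_homB // yy' subrr.
Qed.

Lemma RF_basic_sum (x y : F) : pi x \in N ->
  RF (bracket x y
      - \sum_(j < #|P|) basic_coef deg (crd x) (crd y) (enum_val j) *: g j).
Proof.
move=> /(adapted_memP X) xN.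
rewrite -(big_enum_val (fun p => basic_coef deg (crd x) (crd y) p
                                 *: bracket (b p.1) (b p.2))).
rewrite -(bracket_basic_sum _ nz2 homog_b) //.
have pi_crd z : pi z = pi (\sum_i crd z i *: b i).
  rewrite lie_hom_sum // {1}[pi z]adapted_eq; apply: eq_bigr => i _.
  by rewrite lie_homZ // pi_b.
exact: RF_bracket_cong.
Qed.

(** The basic brackets span [[S, F]] modulo [[R, F]]. *)
Lemma SF_basic_sum (x : F) : SF x ->
  exists a : 'I_#|P| -> K, RF (x - \sum_j a j *: g j).
Proof.
move: x; apply: bracket_span_min => [|x y xN _]; last first.
  by eexists; apply: RF_basic_sum.
split.
  by exists (fun=> 0); rewrite big1 ?subr0; [apply: subspace0|move=> j _; rewrite scale0r].
move=> c x y [a Ha] [a' Ha']; exists (fun j => c * a j + a' j).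
rewrite (_ : _ - _ = c *: (x - \sum_j a j *: g j) + (y - \sum_j a' j *: g j)).
  by apply: subRF.2.
rewrite scalerBr addrACA -opprD scaler_sumr -big_split /=; congr (_ - _).
by apply: eq_bigr => j _; rewrite scalerA -scalerDl.
Qed.

Lemma basic_bound p r (u : 'I_p -> F) (rel : 'M[K]_(r, #|P|)) :
    (forall i, SF (u i)) ->
    (forall c : 'I_p -> K, RF (\sum_i c i *: u i) -> forall i, c i = 0) ->
    (forall i, RF (\sum_j rel i j *: g j)) -> row_free rel ->
  (p + r <= #|P|)%N.
Proof.
move=> SFu indep relP free_rel.
by apply: (indep_mod_leq subRF indep _ relP free_rel) => i; apply: SF_basic_sum.
Qed.

Lemma brv_lift (x : L) : x \in brv N {:L} -> exists2 f, SF f & pi f = x.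
Proof.
move/brvP; move: x; apply: bracket_span_min => [|x y xN _]; last first.
  have [[x' Ex] [y' Ey]] := (surj_pi x, surj_pi y).
  exists (bracket x' y'); last by rewrite lie_homM // Ex Ey.
  by apply: bracket_span_gen; rewrite ?Ex.
split; first by exists 0; [apply: (bracket_span_subspace _ _).1|apply: lie_hom0].
move=> c x y [x' SFx <-] [y' SFy <-]; exists (c *: x' + y').
  exact: (bracket_span_subspace _ _).2.
by rewrite lie_homPZ.
Qed.

(** Since [[S, F] / (R :&: [S, F])] is [[N, L]], the space [[S, F] / [R, F]] has
    dimension [dim M(N, L) + dim [N, L]]. *)
Lemma multiplier_dim_SF d : multiplier_dim pi N d ->
  exists u : 'I_(d + \dim (brv N {:L})) -> F,
    (forall i, SF (u i)) /\
    (forall c : 'I__ -> K, RF (\sum_i c i *: u i) -> forall i, c i = 0).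
Proof.
move=> [v [v_mem v_indep _]].
have tP (i : 'I_(\dim (brv N {:L}))) :
    exists2 f, SF f & pi f = (vbasis (brv N {:L}))`_i.
  by apply/brv_lift/vbasis_mem; rewrite mem_nth ?size_tuple.
have [t SFt pi_t] := fin_all_exists2 tP.
exists (fun i => match split i with inl j => v j | inr j => t j end).
split=> [i|c]; first by case: (split i) => j; [case: (v_mem j) | apply: SFt].
rewrite big_split_ord /= => RFc.
have ker_RF (x : F) : RF x -> pi x = 0.
  move: x; apply: bracket_span_min; first exact: ker_subspace.
  by move=> x y x0 _; rewrite lie_homM // x0 bracket0l.
have splitl (i : 'I_d) : split (lshift (\dim (brv N {:L})) i) = inl i.
  exact: (unsplitK (inl i)).
have splitr (i : 'I_(\dim (brv N {:L}))) : split (rshift d i) = inr i.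
  exact: (unsplitK (inr i)).
have c_r i : c (rshift d i) = 0.
  move: (ker_RF _ RFc); rewrite (lie_homD hom_pi) !(lie_hom_sum hom_pi).
  rewrite big1 => [|j _].
    rewrite add0r => c0.
    have /freeP fr := basis_free (vbasisP (brv N {:L})).
    apply: (fr (fun i => c (rshift d i))).
    rewrite -[RHS]c0; apply: eq_bigr => j _.
    by rewrite splitr lie_homZ // pi_t.
  by rewrite splitl lie_homZ //; have [-> _] := v_mem j; rewrite scaler0.
move: RFc; rewrite [X in _ + X]big1 ?addr0 => [RFc i|i _]; last first.
  by rewrite c_r scale0r.
case: (split_ordP i) => j ->; last exact: c_r.
apply: (v_indep (fun i => c (lshift _ i))).
move: RFc; rewrite (eq_bigr (fun l => c (lshift _ l) *: v l)) // => l _.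
by rewrite splitl.
Qed.

(** * Central elements outside [[N, L]] give a relation *)

(** The homogeneous components of a central element are central. *)
Lemma central_split (z0 z1 : L) : homog false z0 -> homog true z1 ->
    (forall x, bracket (z0 + z1) x = 0) ->
  (forall x, bracket z0 x = 0) /\ (forall x, bracket z1 x = 0).
Proof.
move=> h0 h1 zz0.
have hom a x : homog a x -> bracket z0 x = 0 /\ bracket z1 x = 0.
  move=> hx; have h0x := bracket_homog _ _ _ _ h0 hx.
  have h1x := bracket_homog _ _ _ _ h1 hx.
  have /eqP := zz0 x; rewrite bracketDl addr_eq0 => /eqP E.
  have z0x : bracket z0 x = 0.
    by apply: homog_eq0 h0x _; rewrite E; apply/homogN.
  by split=> //; apply: oppr_inj; rewrite -E z0x oppr0.
split=> x; have [x0 [x1 [/hom[e00 e10] /hom[e01 e11] ->]]] := homog_split x.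
  by rewrite bracketDr e00 e01 addr0.
by rewrite bracketDr e10 e11 addr0.
Qed.

(** If the image of [z] is central in [L], the Jacobi identity shows that [z]
    commutes with all brackets modulo [[R, F]]. *)
Lemma RF_central_bracket (z x y : F) a c : (forall w, bracket (pi z) w = 0) ->
  homog a x -> homog c y -> RF (bracket z (bracket x y)).
Proof.
have [z0 [z1 [h0 h1 ->]]] := homog_split z; rewrite lie_homD // => zc hx hy.
have [zc0 zc1] := central_split (lie_hom_homog hom_pi h0) (lie_hom_homog hom_pi h1) zc.
have part e (t : F) : homog e t -> (forall w, bracket (pi t) w = 0) ->
    RF (bracket t (bracket x y)).
  move=> ht tc; have := bracket_jacobi _ _ _ _ _ _ ht hx hy.
  rewrite -addrA => /eqP; rewrite addr_eq0 => /eqP E.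
  rewrite -[bracket t _]scale1r -(sqrr_sign K (e && c)) expr2 -scalerA E.
  apply: subspaceZ => //; apply: subspaceN => //; apply: subspaceD => //;
    apply: subspaceZ => //; apply: bracket_kerr => //; rewrite lie_homM //.
  by apply: (bracket_anti_eq0 (lie_hom_homog hom_pi ht) (lie_hom_homog hom_pi hy)).
by rewrite bracketDl; apply: subspaceD => //; [apply: (part false)|apply: (part true)].
Qed.

(** If the bracket of [x] and [y] has zero coefficients on all basic brackets and
    [y j] is nonzero with [j < k], then [x] is a multiple of [y]: for [j] odd the
    square of index [(j, j)] gives [x j = 0], so that the signs do not matter. *)
Lemma basic_coef_eq0 (x y : 'I_D -> K) (j : 'I_D) : (j < k)%N -> y j != 0 ->
    (forall p, p \in P -> basic_coef deg x y p = 0) ->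
  forall i, x i * y j = x j * y i.
Proof.
move=> lt_j yj coef0 i.
have x_sign : (-1) ^+ deg j * x j = x j.
  case dj: (deg j); last by rewrite expr0 mul1r.
  have /coef0 : (j, j) \in P by rewrite inE /= lt_j ltnn eqxx dj.
  rewrite /basic_coef /= eqxx => /eqP; rewrite mulf_eq0 (negPf yj) orbF.
  by move=> /eqP ->; rewrite mulr0.
have x_sign_and (e : bool) : (-1) ^+ (e && deg j) * x j = x j.
  by case: e => //; rewrite mul1r.
case: (ltngtP i j) => [lt_ij|lt_ji|/val_inj -> //].
  have /coef0 : (i, j) \in P by rewrite inE /= lt_ij (ltn_trans lt_ij).
  rewrite /basic_coef /= -val_eqE /= ltn_eqF // => /eqP.
  by rewrite subr_eq0 mulrA x_sign_and => /eqP.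
have /coef0 : (j, i) \in P by rewrite inE /= lt_ji lt_j.
rewrite /basic_coef /= -val_eqE /= ltn_eqF // => /eqP.
rewrite subr_eq0 => /eqP E.
rewrite -[x j * y i](_ : (-1) ^+ (deg i && deg j) * (x j * y i) = _).
  by rewrite E andbC mulrA -expr2 sqrr_sign mul1r.
by rewrite mulrA x_sign_and.
Qed.

(** Two elements of [S] with independent images in [N] that commute modulo
    [[R, F]] give a nonzero relation between the basic brackets. *)
Lemma commuting_relation (z w : F) : pi z \in N -> pi w \in N -> pi w != 0 ->
    (forall c, pi z != c *: pi w) -> RF (bracket z w) ->
  exists2 rel : 'M[K]_(1, #|P|),
    forall i, RF (\sum_j rel i j *: g j) & row_free rel.
Proof.
move=> zN wN w_neq0 z_indep RFzw.
exists (\row_j basic_coef deg (crd z) (crd w) (enum_val j)) => [i|].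
  under eq_bigr => j _ do rewrite mxE.
  rewrite -[X in RF X](subKr (bracket z w)); apply: subspaceB => //.
  exact: RF_basic_sum.
rewrite /row_free rank_rV eqb1; apply/eqP => rel_eq0.
have [j wj] : exists j, crd w j != 0.
  apply/existsP; apply: contraR w_neq0; rewrite negb_exists => /forallP w0.
  apply/eqP; rewrite [pi w]adapted_eq big1 // => i _.
  by have := w0 i; rewrite negbK => /eqP; rewrite /crd => ->; rewrite scale0r.
have lt_j : (j < k)%N.
  rewrite ltnNge; apply: contra wj => le_j.
  by apply/eqP; move/(adapted_memP X): wN; apply.
have coef0 p : p \in P -> basic_coef deg (crd z) (crd w) p = 0.
  move=> pP; have := congr1 (fun M : 'rV_ _ => M 0 (enum_rank_in pP p)) rel_eq0.
  by rewrite !mxE enum_rankK_in.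
have prop := basic_coef_eq0 lt_j wj coef0.
case/eqP: (z_indep (crd z j / crd w j)).
rewrite [LHS]adapted_eq [pi w in RHS]adapted_eq scaler_sumr.
apply: eq_bigr => i _; rewrite scalerA; congr (_ *: _).
by rewrite mulrAC -(prop i) mulfK.
Qed.

(** * Independence of the basic brackets for abelian [L] *)

(** A homogeneous vector has nonzero coordinates in its own degree only. *)
Lemma coord_homog a (y : L) (i : 'I_D) : homog a y -> deg i != a ->
  coord (adapted_vec X) i y = 0.
Proof.
move=> hy di.
pose part e := \sum_(l | deg l == e) coord (adapted_vec X) l y *: (adapted_vec X)`_l.
have hpart e : homog e (part e).
  by apply: homog_sum => l /eqP <-; apply/homogZ/adapted_homog.
have yE : y = part a + part (~~ a).
  rewrite [LHS]adapted_eq (bigID (fun l => deg l == a)) /=; congr (_ + _).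
  by apply: eq_bigl => l; case: (deg l); case: (a).
have part0 : part (~~ a) = 0.
  apply: homog_eq0 (hpart _) _; rewrite negbK.
  rewrite -[part (~~ a)](addKr (part a)) -yE.
  by apply: homogD => //; apply: homogN.
rewrite yE part0 addr0 linear_sum big1 //= => l /eqP dl.
rewrite linearZ /= coord_adapted_vec; case: eqP => [eq_li|_]; last by rewrite mulr0.
by rewrite -eq_li dl eqxx in di.
Qed.

(** For abelian [L], freeness of [F] lifts [pi] to a homomorphism into the
    superalgebra of class two on [L]; it kills [[R, F]] and sends the basic
    brackets to independent matrices. *)
Lemma basic_indep : is_free F -> abelian_super {:L} ->
  forall c : 'I_#|P| -> K, RF (\sum_j c j *: g j) -> forall j, c j = 0.
Proof.
move=> [X0 [dg [iota [hom_iota univ]]]] abL.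
pose H : lieSuperalgType K := class2 K deg.
pose f (x : X0) : H := (\row_i crd (iota x) i, 0) : class2 K deg.
have [|phi [hom_phi phi_iota _]] := univ H f.
  move=> x; split=> [i di|i j _]; rewrite mxE //.
  by apply: coord_homog di; apply: lie_hom_homog.
(* psi is phi followed by the projection to L; by uniqueness it is pi. *)
pose psi (x : F) : L := \sum_i (phi x).1 0 i *: (adapted_vec X)`_i.
have hom_psi : lie_hom psi.
  split.
  - move=> a x y; rewrite /psi (lie_homPZ hom_phi) scaler_sumr -big_split /=.
    by apply: eq_bigr => i _; rewrite !mxE scalerDl scalerA.
  - move=> a x /(lie_hom_homog hom_phi) [phi0 _]; apply: homog_sum => i _.
    have [<-|/phi0 ->] := eqVneq (deg i) a; first exact/homogZ/adapted_homog.
    by rewrite scale0r; apply: homog0.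
  - move=> x y; rewrite [RHS]abL ?memvf // /psi (lie_homM hom_phi).
    by apply: big1 => i _; rewrite mxE scale0r.
have [|pi' [_ _ uniq_pi]] := univ L (fun x => pi (iota x)).
  by move=> x; apply: lie_hom_homog.
have pi_psi x : pi x = psi x.
  rewrite (uniq_pi pi) // -(uniq_pi psi) // => y.
  rewrite /psi phi_iota [RHS]adapted_eq; apply: eq_bigr => i _.
  by rewrite mxE.
have crd_phi x i : crd x i = (phi x).1 0 i.
  rewrite /crd pi_psi linear_sum (bigD1 i) //= linearZ /= coord_adapted_vec eqxx.
  rewrite mulr1 big1 ?addr0 // => j /negPf ne_ji.
  by rewrite linearZ /= coord_adapted_vec ne_ji mulr0.
have phi_RF x : RF x -> phi x = 0.
  move: x; apply: bracket_span_min; first exact: ker_subspace.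
  move=> x y x0 _; rewrite (lie_homM hom_phi).
  have phix : (phi x).1 = 0.
    by apply/rowP => i; rewrite -crd_phi /crd x0 linear0 mxE.
  by apply: class2_ext; rewrite //= phix wedge0l.
move=> c /phi_RF sum0 j.
(* The coefficient c j is read off at the matrix entry of index p. *)
pose p := enum_val j; pose ev (h : H) : K := h.2 p.1 p.2.
have crd_b i l : (phi (b i)).1 0 l = (i == l)%:R.
  by rewrite -crd_phi /crd pi_b coord_adapted_vec.
have ev0 : ev 0 = 0 by rewrite /ev mxE.
have evD : {morph ev : u v / u + v} by move=> u v; rewrite /ev mxE.
have ev_sum : ev (phi (\sum_l c l *: g l)) =
    \sum_l c l * (((enum_val l).1 == p.1)%:R * ((enum_val l).2 == p.2)%:R
      - (-1) ^+ (deg p.1 && deg p.2)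
        * (((enum_val l).2 == p.1)%:R * ((enum_val l).1 == p.2)%:R)).
  rewrite (lie_hom_sum hom_phi) (big_morph ev evD ev0).
  apply: eq_bigr => l _; rewrite (lie_homZ hom_phi) /ev mxE; congr (_ * _).
  by rewrite /g (lie_homM hom_phi) mxE !crd_b.
have pP : p \in P by apply: enum_valP.
move: ev_sum; rewrite sum0 /ev [LHS]mxE (bigD1 j) //= big1 => [|l ne_lj]; last first.
  have ne_lp : enum_val l != p by rewrite (inj_eq enum_val_inj).
  have lP : enum_val l \in P by apply: enum_valP.
  move: (enum_val l) (p) ne_lp lP pP => [i1 i2] [j1 j2].
  rewrite !inE /= xpair_eqE => ne_lp /andP[_ lP] /andP[_ pP].
  have ne_swap : ~~ ((i2 == j1) && (i1 == j2)).
    apply: contra ne_lp => /andP[/eqP E2 /eqP E1]; move: lP pP.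
    rewrite -E1 -E2 => /orP[lt_12|/andP[/eqP -> _]]; last by rewrite eqxx.
    by case/orP=> [/(ltn_trans lt_12)|/andP[/eqP -> _]]; rewrite ?ltnn ?eqxx.
  by rewrite -!natrM !mulnb (negPf ne_lp) (negPf ne_swap) mulr0 subr0 mulr0.
rewrite -/p addr0 !eqxx mulr1 => /esym/eqP; rewrite mulf_eq0 => /orP[/eqP //|].
move: pP; rewrite inE => /andP[_ /orP[lt_p|/andP[/eqP <- ->]]].
  by rewrite -[p.1 == p.2]val_eqE ltn_eqF // mulr0 mulr0 subr0 oner_eq0.
by rewrite eqxx expr1 mulr1 mulN1r opprK -mulr2n (negPf nz2).
Qed.

End Presentation.

(** * Nilpotency and the dimension of [[N, L]] *)

Lemma brv_mem (K : fieldType) (L : vectLieSuperalgType K) (U W : {vspace L}) x y :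
  x \in U -> y \in W -> bracket x y \in brv U W.
Proof. by move=> xU yW; apply/brvP; apply: bracket_span_gen. Qed.

(** In a nilpotent superalgebra [L] with ideal [N], if [[N, L]] is a line, it is
    central: bracketing with [x] acts on it by a scalar, and a nonzero scalar
    would keep it inside all terms of the lower central series. *)
Lemma brv_line_central (K : fieldType) (L : vectLieSuperalgType K)
    (N : {vspace L}) : (brv N {:L} <= N)%VS -> nilpotent_super {:L} ->
  \dim (brv N {:L}) = 1%N -> forall w x, w \in brv N {:L} -> bracket w x = 0.
Proof.
move=> /subvP idN [c lcs0] dim1 w x wN.
have [->|w_neq0] := eqVneq w 0; first exact: bracket0l.
have lineE : brv N {:L} = <[w]>%VS.
  by apply/eqP; rewrite eq_sym eqEdim -memvE wN dim1 dim_vline w_neq0.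
have : bracket w x \in brv N {:L} by apply: brv_mem; rewrite ?memvf ?idN.
rewrite lineE => /vlineP[a wx]; rewrite wx.
have [->|a_neq0] := eqVneq a 0; first by rewrite scale0r.
suff : w \in lcs {:L} c by rewrite lcs0 memv0 (negPf w_neq0).
elim: (c) => [|i IH]; first exact: memvf.
rewrite -[w](scalerK a_neq0) -wx; apply/memvZ/brv_mem => //; exact: memvf.
Qed.

Theorem theorem3p11 (K : closedFieldType)
    (char2 : 2%N \notin [pchar K]) (char3 : 3%N \notin [pchar K])
    (L : vectLieSuperalgType K) (N : {vspace L})
    (idealN : graded_ideal N)
    (nilL : nilpotent_super {:L})
    (complN : exists W : {vspace L}, is_complement N W)
    (m n : nat) (dimN : superdim N m n)
    (F : lieSuperalgType K) (pi : F -> L) (presL : free_presentation pi)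
    (d : nat) (dimM : multiplier_dim pi N d)
    (dimME : d%:R =
       2%:R^-1 * ((m%:R + n%:R) ^+ 2 + (n%:R - m%:R))
       + (\dim N)%:R * (\dim {:L} - \dim N)%N%:R - 1 :> rat) :
  ~ abelian_super {:L} /\
  (brv N {:L} = 0%VS \/
   (\dim (brv N {:L}) = 1%N /\
    forall z : L, z \in brv N {:L} <-> pair_center N z)).
Proof.
have nz2 : 2%:R != 0 :> K by move: char2; rewrite inE.
have [grN idN] := idealN; have [freeF hom_pi surj_pi] := presL.
have [X [sum_deg dimNE]] := adapted_basis_exists grN complN dimN.
have leND : (\dim N <= \dim {:L})%N by rewrite dimvS ?subvf.
have [b homog_b pi_b] := fin_all_exists2 (fun i : 'I_(\dim {:L}) =>
  lift_homog hom_pi (surj_pi (adapted_vec X)`_i) (adapted_homog X i)).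
set P := basic_pairs (\dim N) (adapted_deg X).
have cardP : #|P| = d.+1.
  have := card_basic_pairs (adapted_deg X) leND; rewrite sum_deg -/P.
  move=> /(congr1 (fun e => e%:R : rat)); rewrite !natrD !natrM => E.
  apply/eqP; rewrite -(Num.Theory.eqr_nat rat) -addn1 natrD dimME natrB //.
  by apply/eqP; move: E; rewrite dimNE natrD; lra.
split.
  move=> abL; have [v [v_mem _ v_gen]] := dimM.
  have indep := basic_indep nz2 hom_pi pi_b freeF abL.
  suff : (#|P| + 0 <= d)%N by rewrite cardP addn0 ltnn.
  apply: (indep_mod_leq (bracket_span_subspace _ _) indep
    (g := v) (rel := 0)) => [j|[]|] //; last by rewrite /row_free mxrank0.
  apply: v_gen; split; first by rewrite lie_homM // abL ?memvf.
  apply: bracket_span_gen => //; rewrite pi_b; apply: adapted_vec_mem.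
  by have := enum_valP j; rewrite inE => /andP[].
have [u [SFu u_indep]] := multiplier_dim_SF hom_pi surj_pi dimM.
have bound r (rel : 'M[K]_(r, #|P|)) := basic_bound nz2 hom_pi homog_b pi_b
  (rel := rel) SFu u_indep.
have : (\dim (brv N {:L}) <= 1)%N.
  have le_dP : (d + \dim (brv N {:L}) + 0 <= #|P|)%N.
    by apply: (bound 0%N 0) => [[]|] //; rewrite /row_free mxrank0.
  by move: le_dP; rewrite cardP addn0 -addn1 leq_add2l.
case dim_brv: (\dim (brv N {:L})) => [|[|//]] _; [left | right; split=> // z].
  by apply/eqP; rewrite -dimv_eq0 dim_brv.
have line_central := brv_line_central idN nilL dim_brv.
split=> [zN|[zN zc]].
  by split=> [|x]; [apply: (subvP idN) | apply: line_central].
apply: contraT => z_notin.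
(* [N, L] is spanned by a bracket w of two vectors of the adapted basis. *)
have [i lt_i /existsP[j w_neq0]] : exists2 i : 'I_(\dim {:L}), (i < \dim N)%N &
    [exists j : 'I_(\dim {:L}), bracket (adapted_vec X)`_i (adapted_vec X)`_j != 0 :> L].
  apply/exists_inP; apply: contraT => /exists_inPn E.
  have : (brv N {:L} <= 0)%VS.
    apply/subvP => x /brvP; move: x; apply: bracket_span_min => [|s t sN _].
      by split=> [|c s t sN tN]; [apply: mem0v | rewrite memvD ?memvZ].
    rewrite (adapted_eq X s) (adapted_eq X t) bracket_suml.
    rewrite big1 ?mem0v // => i _; rewrite bracketZl.
    have [lt_i|le_i] := ltnP i (\dim N); last first.
      by move/(adapted_memP X): sN => ->; rewrite ?scale0r.
    rewrite bracket_sumr big1 ?scaler0 // => j _; rewrite bracketZr.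
    have /existsPn/(_ j) := E i lt_i.
    by rewrite negbK => /eqP ->; rewrite scaler0.
  by rewrite subv0 -dimv_eq0 dim_brv.
set w := bracket _ _ in w_neq0.
have wN : w \in brv N {:L} by apply: brv_mem; [apply: adapted_vec_mem | apply: memvf].
have pi_w : pi (bracket (b i) (b j)) = w by rewrite lie_homM // !pi_b.
have [z' zE] := surj_pi z.
have [|||||rel relP free_rel] :=
  commuting_relation (X := X) (z := z') (w := bracket (b i) (b j))
    nz2 hom_pi homog_b pi_b.
- by rewrite zE.
- by rewrite pi_w (subvP idN).
- by rewrite pi_w.
- by move=> c; rewrite zE pi_w; apply: contra z_notin => /eqP ->; apply: memvZ.
- by apply: (RF_central_bracket hom_pi _ (homog_b i) (homog_b j)) => x; rewrite zE.
have le_dP : (d + \dim (brv N {:L}) + 1 <= #|P|)%N by apply: bound free_rel.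
by move: le_dP; rewrite cardP dim_brv !addn1 ltnn.
Qed.
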